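(* Let $X$ be a real-valued random variable on a probability space $(\Omega,\mathcal{F},\mathbb{P})$ with non-degenerate distribution $\mu=\mathbb{P}_X$ and such that $\mathbb{E}[X^2]<\infty$. Put $m=\mathbb{E}[X]$, $0<\sigma^2=\operatorname{Var}(X)$ and $I=(\operatorname{ess\,inf}(X),\operatorname{ess\,sup}(X))$. Then there exists a Stein kernel $\tau_X$ for $X$ if and only if the absolutely continuous part $\mu_{ac}$ of $\mu$ has a Lebesgue density $p=\frac{d\mu_{ac}}{d\lambda}$ which is strictly positive on $I$. In this case, the Stein kernel $\tau_X$ is $\mu$-a.e. unique, and a version of it is given by $$\tau_X(t)=\sigma^2\frac{q(t)}{p(t)}h(t),\quad t\in I,$$ and $\tau_X(t)=0$ for $t\in\mathbb{R}\setminus I$, where $$q(t)=\frac{1}{\sigma^2}\mathbb{E}\bigl[(X-m)\mathbf{1}_{\{X\geq t\}}\bigr],\quad t\in\mathbb{R},$$ is the probability density function of the $X$-non-zero biased distribution and $h=\frac{d\mu_{ac}}{d\mu}:\mathbb{R}\to[0,1]$ is a Radon-Nikodym derivative of $\mu_{ac}$ with respect to $\mu$. In particular, $\tau_X$ is $\lambda$-a.e. positive on the closure $\bar{I}$ of $I$. Moreover, it necessarily holds that $\tau_X(t)=0$ for $\mu_s$-a.e. $t\in\mathbb{R}$. In particular, $\tau_X(c)=0$ whenever $\mathbb{P}(X=c)>0$.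
   Context: $\lambda$ denotes Lebesgue measure on the Borel $\sigma$-field $\mathcal{B}(\mathbb{R})$. Stein kernel: for a real random variable $X$ with $\mathbb{E}|X|<\infty$, distribution $\mu$ and mean $m$, a Borel-measurable function $\tau_X:\mathbb{R}\to\mathbb{R}$ is called a Stein kernel for $X$ (or for $\mu$) if $$\mathbb{E}[\tau_X(X)f'(X)]=\mathbb{E}[(X-m)f(X)]$$ for all continuously differentiable $f:\mathbb{R}\to\mathbb{R}$ with bounded derivative $f'$ (the expectations being required to exist; with $f(x)=x$ this includes $\mu$-integrability of $\tau_X$). Essential bounds: $\operatorname{ess\,inf}(X)=\sup\{t\in\mathbb{R}:\mathbb{P}(X<t)=0\}\in[-\infty,\infty)$ and $\operatorname{ess\,sup}(X)=\inf\{t\in\mathbb{R}:\mathbb{P}(X>t)=0\}\in(-\infty,\infty]$. The closure $\bar I$ is taken in $\mathbb{R}$. Lebesgue decomposition: $\mu=\mu_{ac}+\mu_s$, where $\mu_{ac}$ is absolutely continuous with respect to $\lambda$ and $\mu_s$ (the sum of the discrete part and the singular continuous part of $\mu$) is singular with respect to $\lambda$. Since $\mu_{ac}\le\mu$, there is a Borel function $h:\mathbb{R}\to[0,1]$ with $\mu_{ac}(B)=\int_B h\,d\mu$ for all $B\in\mathcal{B}(\mathbb{R})$. The $X$-non-zero biased distribution $\mu^{nz}$ is the probability measure on $(\mathbb{R},\mathcal{B}(\mathbb{R}))$ satisfying $\sigma^2\int_{\mathbb{R}} f'\,d\mu^{nz}=\mathbb{E}[(X-m)f(X)]$ for all continuously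 differentiable $f$ with bounded derivative; it is absolutely continuous with respect to $\lambda$ with the density $q$ given in the claim. *)

(* Defs.v *)
From HB Require Import structures.
From mathcomp Require Import all_boot all_order all_algebra.
From mathcomp Require Import all_classical all_reals all_analysis ess_sup_inf.
Set Implicit Arguments.
Unset Strict Implicit.
Unset Printing Implicit Defensive.
Import Order.TTheory GRing.Theory Num.Theory.
Import numFieldNormedType.Exports.
Local Open Scope classical_set_scope.
Local Open Scope ring_scope.

Section measures.
Context d (T : measurableType d) (R : realType).
(* Some arguments are bare set functions so that [lebesgue_measure], which lives
   on [measurableTypeR R], and measures on the canonical Borel structure of [R]
   (same measurable sets, different display) can be used together. *)
Implicit Types (mu : {measure set T -> \bar R}) (nu rho : set T -> \bar R).

(* [f] is an everywhere defined version of the Radon-Nikodym derivative of [nu]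
   with respect to [mu]; the versions are quantified over explicitly, since the
   chosen representative ['d nu '/d mu] need not be the pointwise positive one. *)
Definition is_density mu nu (f : T -> R) :=
  [/\ measurable_fun [set: T] f,
      forall x, 0 <= f x
    & forall B, measurable B -> nu B = (\int[mu]_(x in B) (f x)%:E)%E].

Definition mutually_singular nu rho :=
  exists N : set T, [/\ measurable N, nu (~` N) = 0%E & rho N = 0%E].

Definition Lebesgue_decomposition nu rho (nu_ac nu_s : {measure set T -> \bar R}) :=
  [/\ forall B, measurable B -> nu B = (nu_ac B + nu_s B)%E,
      nu_ac `<< rho
    & mutually_singular nu_s rho].

End measures.

Definition C1_bounded_deriv (R : realType) (f : R -> R) :=
  [/\ forall x, derivable f x 1,
      continuous (derive1 f)
    & exists M, forall x, `|derive1 f x| <= M].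

Section random_variable.
Context d (Omega : measurableType d) (R : realType) (P : probability Omega R).
Implicit Type X : {RV P >-> R}.

Definition mean X : R := fine ('E_P[X])%E.

Definition var X : R := fine ('V_P[X])%E.

Definition nondegenerate_RV X := forall c, P [set w | X w = c] <> 1%E.

Definition ess_interval X : set R :=
  [set t | (ess_infr P X < t%:E < ess_supr P X)%E].

Definition is_Stein_kernel X (tau : R -> R) :=
  measurable_fun [set: R] tau /\
  forall f, C1_bounded_deriv f ->
    [/\ P.-integrable [set: Omega] (fun w => (tau (X w) * derive1 f (X w))%:E),
        P.-integrable [set: Omega] (fun w => ((X w - mean X) * f (X w))%:E)
      & ('E_P[fun w => (tau (X w) * derive1 f (X w))%R]
         = 'E_P[fun w => ((X w - mean X) * f (X w))%R])%E].

Definition is_nonzero_biased X (nu : probability (measurableTypeR R) R) :=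
  forall f, C1_bounded_deriv f ->
    ((var X)%:E * \int[nu]_x (derive1 f x)%:E
     = 'E_P[fun w => ((X w - mean X) * f (X w))%R])%E.

Definition nzb_density X (t : R) : R :=
  (var X)^-1 *
  fine ('E_P[fun w => ((X w - mean X) * \1_[set w' | t <= X w'] w)%R])%E.

End random_variable.

(* Main.v *)
Require Import Defs.
From HB Require Import structures.
From mathcomp Require Import all_boot all_order all_algebra.
From mathcomp Require Import all_classical all_reals all_analysis ess_sup_inf.
From mathcomp Require Import measurable_realfun.
From mathcomp Require Import ring lra.
Set Implicit Arguments.
Unset Strict Implicit.
Unset Printing Implicit Defensive.
Import Order.TTheory GRing.Theory Num.Theory.
Import numFieldNormedType.Exports.
Import HBNNSimple.
Local Open Scope classical_set_scope.
Local Open Scope ring_scope.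

(** Write [m], [s2] for the mean and the variance of [X], [P] for the probability,
[mu] for the law of [X] and [g t = E[(X - m) 1{X >= t}]], so that the density [q]
of the claim is [g / s2].

The one analytic fact is the identity
[E[(X - m) f(X)] = \int f'(t) g(t) dt] for every C1 function [f] with bounded
derivative. It comes from Fubini's theorem: by the fundamental theorem of calculus
[(x - m) (f x - f m)] is the integral of [f'] against the kernel
[(x - m) (1{t <= x} - 1{t <= m})], which is nonnegative, and whose mean over
[x = X] is [g t] because [X - m] is centered ([integral_peano_kernel],
[nzb_densityE], [integral_mean_kernel]).

Consequently [tau] is a Stein kernel if and only if the signed measures [tau mu]
and [g dt] give the same integral to every [f'], hence, derivatives of C1 functions
being rich enough to approximate half-lines, if and only if [tau mu = g dt] as
measures ([same_weighted_law_of_C1], [Stein_kernel_law] and, for nonnegative [tau],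
[Stein_kernel_of_law]). The same argument shows that the non-zero biased law is
[q dt] ([nonzero_biased_density], [exists_nonzero_biased]).

All claims are read off the equality [tau mu = g dt], together with the fact that
[g] is positive on the interval [I] between the essential bounds of [X] and
vanishes outside [I] with the possible exception of the upper end point
([mean_kernel_gt0], [mean_kernel_eq0]):
- [tau] is determined [mu]-almost everywhere;
- [tau mu] vanishes on every Borel subset of a Lebesgue null set, so that [tau] is 0
  [mu]-almost everywhere on such a set; this applies to atoms and to a Lebesgue null
  set [N] carrying [mu_s];
- on the part of [I] where [tau <= 0] the integral of [g] is at most 0, so this
  part is Lebesgue null;
- on the part of [I] outside [N] where the density [p] of [mu_ac] vanishes, [mu]
  vanishes too, hence the integral of [g] is 0 and this part is Lebesgue null.
  Changing [p] on it makes [p] positive on all of [I];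
- conversely, if [p > 0] on [I] and [h = d mu_ac / d mu], then
  [(g / p) h mu = (g / p) mu_ac = (g / p) p dt = g dt] on [I]. *)

(** * Measurability and null sets *)

Lemma measurable_preimageT d1 d2 (T1 : measurableType d1) (T2 : measurableType d2)
    (X : T1 -> T2) (B : set T2) :
  measurable_fun [set: T1] X -> measurable B -> measurable (X @^-1` B).
Proof. by move=> mX mB; rewrite -[X @^-1` _]setTI; exact: mX. Qed.

Lemma measurable_fun_mem d (T : measurableType d) (A : set T) :
  measurable A -> measurable_fun [set: T] (fun t => t \in A).
Proof.
move=> mA; apply: (measurable_fun_bool true); rewrite setTI.
rewrite (_ : _ @^-1` _ = A)//.
by apply/seteqP; split=> t /=; [exact: set_mem|exact: mem_set].
Qed.

Lemma integral_mul_indic d (T : measurableType d) (R : realType)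
    (mu : {measure set T -> \bar R}) (Y f : T -> R) (B : set R) :
  (\int[mu]_x (f x * \1_B (Y x))%:E = \int[mu]_(x in Y @^-1` B) (f x)%:E)%E.
Proof.
rewrite [RHS]integral_mkcond; apply: eq_integral => x _; rewrite patchE.
case: ifPn => [/set_mem xB|/negP xB].
  by rewrite indicE mem_set// mulr1.
by rewrite indicE memNset ?mulr0// => xB'; apply: xB; exact: mem_set.
Qed.

Lemma integral_gt0_null d (T : measurableType d) (R : realType)
    (mu : {measure set T -> \bar R}) (D : set T) (f : T -> R) :
  measurable D -> measurable_fun D f -> (forall x, D x -> 0 < f x) ->
  (\int[mu]_(x in D) (f x)%:E <= 0)%E -> mu D = 0%E.
Proof.
move=> mD mf f0 If.
have : (\int[mu]_(x in D) `|(f x)%:E| = 0)%E.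
  apply/eqP; rewrite eq_le integral_ge0 ?andbT// (le_trans _ If)//.
  rewrite le_eqVlt; apply/orP; left; apply/eqP; apply: eq_integral => x /set_mem Dx.
  by rewrite gee0_abs// lee_fin ltW// f0.
move/ae_eq_integral_abs => /(_ mD) /(_ _)[]; first exact/measurable_EFinP.
move=> N [mN N0 DN]; apply/eqP; rewrite eq_le measure_ge0 andbT -N0.
apply: le_measure; rewrite ?inE// => x Dx; apply: DN => /= /(_ Dx) [fx].
by have := f0 _ Dx; rewrite fx ltxx.
Qed.

(** * Smooth approximations of half-lines *)

(** A primitive of the logistic function of steepness [k ^+ 2] centered at
[a + k^-1]: the shift of the center makes the limit at [a] equal to 0, so that the
derivatives converge at every point to the indicator of an open half-line. *)
Definition softplus (R : realType) (a k t : R) : R :=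
  k ^- 2 * ln (1 + expR (k * (k * (t - a) - 1))).

Lemma derive1_softplus (R : realType) (a k : R) : 0 < k ->
  derive1 (softplus a k) = fun t => (1 + expR (k * (1 - k * (t - a))))^-1.
Proof.
move=> k0; apply/funext => t; rewrite derive1E.
have e0 : 0 < 1 + expR (k * (k * (t - a) - 1)) by rewrite addr_gt0 ?expR_gt0.
have dln := @is_derive1_ln R _ e0.
rewrite /softplus derive_val.
rewrite add0r mul1r !subr0 /GRing.scale/= mulr1.
have -> : k * (1 - k * (t - a)) = - (k * (k * (t - a) - 1)) by ring.
rewrite expRN; have := expR_gt0 (k * (k * (t - a) - 1)).
move: (expR _) e0 => e e0 e1.
field; rewrite !gt_eqF//; lra.
Qed.

Lemma normr_derive1_softplus_le1 (R : realType) (a k t : R) : 0 < k ->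
  `|derive1 (softplus a k) t| <= 1.
Proof.
move=> k0; rewrite derive1_softplus//.
have e0 := expR_gt0 (k * (1 - k * (t - a))).
rewrite ger0_norm ?invr_ge0 ?addr_ge0 ?expR_ge0//.
by rewrite invf_cp1 ?addr_gt0// lerDl ltW.
Qed.

Lemma C1_softplus (R : realType) (a k : R) : 0 < k ->
  C1_bounded_deriv (softplus a k).
Proof.
move=> k0; split.
- move=> t.
  have e0 : 0 < 1 + expR (k * (k * (t - a) - 1)) by rewrite addr_gt0 ?expR_gt0.
  have dln := @is_derive1_ln R _ e0.
  exact: ex_derive.
- rewrite derive1_softplus// => t.
  apply: cvgV; first by rewrite gt_eqF// addr_gt0 ?expR_gt0.
  apply: cvgD; first exact: cvg_cst.
  apply: continuous_comp; last exact: continuous_expR.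
  apply: cvgM; first exact: cvg_cst.
  apply: cvgB; first exact: cvg_cst.
  apply: cvgM; first exact: cvg_cst.
  apply: cvgB; [exact: cvg_id|exact: cvg_cst].
- by exists 1 => t; exact: normr_derive1_softplus_le1.
Qed.

(** With [s = k (1 - k (t - a))] the derivative is [(1 + expR s)^-1]. If [t <= a]
then [s >= k]; if [t > a] then [s <= - k] as soon as [k (t - a) >= 2]. In both
cases [1 + s <= expR s] bounds the distance to the limit by [k^-1]. *)
Lemma cvg_derive1_softplus (R : realType) (a t : R) :
  derive1 (softplus a n.+1%:R) t @[n --> \oo] --> (\1_`]a, +oo[%classic t : R).
Proof.
apply/subr_cvg0.
apply: (@squeeze_cvgr _ _ _ _ (fun n => - @harmonic R n) (@harmonic R)); last 2 first.
- by rewrite -[X in _ --> X]oppr0; apply: cvgN; exact: cvg_harmonic.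
- exact: cvg_harmonic.
near=> n; rewrite -ler_norml derive1_softplus// /harmonic/= indicE.
set k := n.+1%:R; have k0 : 0 < k :> R by rewrite ltr0n.
set s := k * (1 - k * (t - a)); have e0 := expR_gt0 s.
have [ta|ta] := leP t a.
- rewrite memNset/=; last by rewrite in_itv/= andbT ltNge ta.
  have ks : k <= expR s.
    apply: le_trans (expR_ge1Dx s); rewrite /s.
    suff : 0 <= k * (k * (a - t)) by lra.
    by rewrite !mulr_ge0 ?subr_ge0// ltW.
  rewrite subr0 ger0_norm ?invr_ge0; last lra.
  by rewrite lef_pV2 ?posrE//; lra.
- rewrite mem_set/=; last by rewrite in_itv/= andbT.
  have kta : 2 <= k * (t - a).
    rewrite -ler_pdivrMr ?subr_gt0//.
    apply: (@le_trans _ _ n%:R); last by rewrite ler_nat.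
    near: n; exact: nbhs_infty_ger.
  have ks : k <= expR (- s).
    apply: le_trans (expR_ge1Dx _); rewrite /s.
    suff : 0 <= k * (k * (t - a) - 2) by lra.
    by rewrite mulr_ge0 ?subr_ge0// ltW.
  have -> : (1 + expR s)^-1 - 1 = - (1 + expR (- s))^-1.
    by rewrite expRN; field; rewrite !gt_eqF//; lra.
  rewrite normrN ger0_norm ?invr_ge0; last lra.
  by rewrite lef_pV2 ?posrE//; lra.
Unshelve. all: by end_near. Qed.

Lemma C1_id (R : realType) : C1_bounded_deriv (@id R).
Proof.
split=> [x| |]; first exact: ex_derive.
- rewrite (_ : derive1 id = cst 1) => [x|]; first exact: cvg_cst.
  by apply/funext => x; rewrite derive1_id.
- by exists 1 => x; rewrite derive1_id normr1.
Qed.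

Lemma measurable_derive1_C1 (R : realType) (f : R -> R) :
  C1_bounded_deriv f -> measurable_fun [set: R] (derive1 f).
Proof. by move=> [_ cf _]; exact: continuous_measurable_fun. Qed.

Lemma cvg_integral_derive1_softplus d (T : measurableType d) (R : realType)
    (m : {measure set T -> \bar R}) (X f : T -> R) (a : R) :
  measurable_fun [set: T] X -> m.-integrable [set: T] (EFin \o f) ->
  (\int[m]_x (f x * derive1 (softplus a n.+1%:R) (X x))%:E)%E @[n --> \oo] -->
  (\int[m]_(x in X @^-1` `]a, +oo[) (f x)%:E)%E.
Proof.
move=> mX If.
have mf : measurable_fun [set: T] f by exact/measurable_EFinP/(measurable_int _ If).
have mXa : measurable (X @^-1` `]a, +oo[).
  exact: measurable_preimageT.
rewrite -integral_mul_indic.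
case: (@dominated_convergence _ T R m setT measurableT
  (fun n x => (f x * derive1 (softplus a n.+1%:R) (X x))%:E)
  (fun x => (f x * \1_`]a, +oo[%classic (X x))%:E) (abse \o (EFin \o f))) => [|||||//].
- move=> n; apply/measurable_EFinP/measurable_funM => //.
  apply: measurableT_comp => //; apply: measurable_derive1_C1.
  exact: C1_softplus.
- by apply/measurable_EFinP/measurable_funM => //; apply: measurableT_comp.
- apply/aeW => x _; apply: cvg_EFin; first exact: nearW.
  by apply: cvgM; [exact: cvg_cst|exact: cvg_derive1_softplus].
- exact: integrable_abse.
- apply/aeW => x n _ /=; rewrite lee_fin normrM ler_piMr//.
  exact: normr_derive1_softplus_le1.
Qed.

(** * Weighted laws *)

(** The push-forwards of [f1 m1] by [X1] and of [f2 m2] by [X2] agree. Comparing the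
two sides as integrals over their own spaces, rather than as measures on [R], allows
[f1] and [f2] to change sign and lets the Lebesgue measure, the law of [X] and their
different Borel structures on [R] be treated alike. *)
Definition same_weighted_law d1 d2 (T1 : measurableType d1)
    (T2 : measurableType d2) (R : realType)
    (m1 : {measure set T1 -> \bar R}) (X1 f1 : T1 -> R)
    (m2 : {measure set T2 -> \bar R}) (X2 f2 : T2 -> R) :=
  forall B : set R, measurable B ->
    (\int[m1]_(x in X1 @^-1` B) (f1 x)%:E =
     \int[m2]_(x in X2 @^-1` B) (f2 x)%:E)%E.

(** The integral is the limit of those of the simple functions approximating [phi];
the right-hand side mentions [m], [X] and [f] only through the weighted law of [X],
which is what makes [same_weighted_law_integral] a rewriting. *)
Lemma weighted_integral_approx d (T : measurableType d) (R : realType)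
    (m : {measure set T -> \bar R}) (X f : T -> R) (phi : R -> R)
    (mphi : measurable_fun [set: R] (EFin \o phi)) :
  measurable_fun [set: T] X -> measurable_fun [set: T] f ->
  (forall x, 0 <= f x) -> (forall t, 0 <= phi t) ->
  (\int[m]_x (phi (X x) * f x)%:E =
   limn (fun n => \sum_(y \in range (nnsfun_approx measurableT mphi n))
     (y%:E * \int[m]_(x in X @^-1` (nnsfun_approx measurableT mphi n @^-1` [set y]))
        (f x)%:E)))%E.
Proof.
move=> mX mf f0 phi0.
set h := nnsfun_approx measurableT mphi.
have mXh n y : measurable (X @^-1` (h n @^-1` [set y])).
  by apply: measurable_preimageT => //; exact: measurable_funPTI.
transitivity (limn (fun n => \int[m]_x (h n (X x) * f x)%:E)%E).
  rewrite -monotone_convergence//=.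
  - apply: eq_integral => x _; apply/esym/cvg_lim => //.
    have : (EFin \o h n) (X x) @[n --> \oo] --> (phi (X x))%:E.
      by apply: cvg_nnsfun_approx => // t _; rewrite lee_fin.
    move=> /(@cvgeZr _ _ _ _ _ (f x)%:E); rewrite -EFinM; exact.
  - move=> n; apply/measurable_EFinP/measurable_funM => //.
    by apply: measurableT_comp => //; exact/measurable_funP.
  - by move=> n x _; rewrite lee_fin mulr_ge0.
  - move=> x _ a b ab; rewrite lee_fin ler_wpM2r//.
    exact/lefP/nd_nnsfun_approx.
congr (limn _); apply/funext => n.
transitivity (\int[m]_x (\sum_(y \in range (h n))
    (y * \1_(X @^-1` (h n @^-1` [set y])) x * f x)%:E))%E.
  apply: eq_integral => x _; rewrite [in LHS]fimfunE fsumEFin//.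
  by rewrite mulr_fsuml.
rewrite ge0_integral_fsum//; last 2 first.
- by move=> y; apply/measurable_EFinP; do 2 apply: measurable_funM => //.
- move=> y x _; rewrite lee_fin mulr_ge0//.
  by have := nnfun_muleindic_ge0 (h n) y (X x); rewrite lee_fin.
apply: eq_fsbigr => y /[!inE] -[z _ hz].
under eq_integral do rewrite -mulrA EFinM.
rewrite ge0_integralZl//.
- congr (_ * _)%E; rewrite -[RHS]integral_mul_indic.
  by apply: eq_integral => x _; rewrite mulrC.
- by apply/measurable_EFinP/measurable_funM.
- by move=> x _; rewrite lee_fin mulr_ge0.
- by rewrite lee_fin -hz.
Qed.

Section weighted_laws.
Context d1 d2 (T1 : measurableType d1) (T2 : measurableType d2) (R : realType).
Context (m1 : {measure set T1 -> \bar R}) (m2 : {measure set T2 -> \bar R}).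
Context (X1 f1 : T1 -> R) (X2 f2 : T2 -> R).
Hypothesis mX1 : measurable_fun [set: T1] X1.
Hypothesis mX2 : measurable_fun [set: T2] X2.

Lemma same_weighted_law_integral (phi : R -> R) :
  measurable_fun [set: T1] f1 -> measurable_fun [set: T2] f2 ->
  (forall x, 0 <= f1 x) -> (forall x, 0 <= f2 x) ->
  measurable_fun [set: R] phi ->
  same_weighted_law m1 X1 f1 m2 X2 f2 ->
  (\int[m1]_x (f1 x * phi (X1 x))%:E = \int[m2]_x (f2 x * phi (X2 x))%:E)%E.
Proof.
move=> mf1 mf2 f10 f20 mphi f12.
under eq_integral do rewrite mulrC.
under [RHS]eq_integral do rewrite mulrC.
have ge0 (psi : R -> R) : measurable_fun [set: R] psi -> (forall t, 0 <= psi t) ->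
    (\int[m1]_x (psi (X1 x) * f1 x)%:E = \int[m2]_x (psi (X2 x) * f2 x)%:E)%E.
  move=> mpsi psi0; have {}mpsi := (measurable_EFinP _ _).2 mpsi.
  rewrite !(weighted_integral_approx _ mpsi)//; congr (limn _); apply/funext => n.
  by apply: eq_fsbigr => y _; rewrite f12.
have pos d (T : measurableType d) (X f : T -> R) : (forall x, 0 <= f x) ->
    ((fun x => (phi (X x) * f x)%:E)^\+ =
     fun x => (Num.max (phi (X x)) 0 * f x)%:E)%E.
  move=> f0; apply/funext => x; rewrite funeposE -EFin_max; congr EFin.
  by rewrite maxr_pMl// mul0r.
have neg d (T : measurableType d) (X f : T -> R) : (forall x, 0 <= f x) ->
    ((fun x => (phi (X x) * f x)%:E)^\- =
     fun x => (Num.max (- phi (X x)) 0 * f x)%:E)%E.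
  move=> f0; apply/funext => x; rewrite funenegE -EFinN -EFin_max; congr EFin.
  by rewrite maxr_pMl// mul0r mulNr.
(* The weights are nonnegative, so the parts of the integrand come from those
   of [phi]. *)
rewrite [LHS]integralE [RHS]integralE !pos// !neg//; congr (_ - _)%E.
- apply: (ge0 (fun t => Num.max (phi t) 0)) => [|t].
    exact: measurable_maxr.
  by rewrite le_max lexx orbT.
- apply: (ge0 (fun t => Num.max (- phi t) 0)) => [|t].
    by apply: measurable_maxr => //; exact: measurableT_comp.
  by rewrite le_max lexx orbT.
Qed.

(** Measures are determined by their integrals of derivatives of C1 functions with
bounded derivative, since the derivatives of [softplus a n] tend boundedly to the
indicator of the half-line of the points above [a]. *)
Lemma same_weighted_law_of_C1 :
  m1.-integrable [set: T1] (EFin \o f1) ->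
  m2.-integrable [set: T2] (EFin \o f2) ->
  (forall f : R -> R, C1_bounded_deriv f ->
     \int[m1]_x (f1 x * derive1 f (X1 x))%:E =
     \int[m2]_x (f2 x * derive1 f (X2 x))%:E)%E ->
  same_weighted_law m1 X1 f1 m2 X2 f2.
Proof.
move=> if1 if2 f12.
(* The identity has derivative 1, so it tests the total masses. *)
have total : (\int[m1]_x (f1 x)%:E = \int[m2]_x (f2 x)%:E)%E.
  have := f12 id (@C1_id R).
  under eq_integral do rewrite derive1_id mulr1.
  by under [RHS]eq_integral do rewrite derive1_id mulr1.
have tpre (T : Type) (X : T -> R) (F : (set R)^nat) :
    trivIset setT F -> trivIset setT (fun n => X @^-1` F n).
  by move=> tF i j _ _ [x [xi xj]]; apply: tF => //; exists (X x).
(* Dynkin's lemma on the half-lines. *)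
move=> B mB; apply: (dynkin_induction (G := @RGenOInfty.G R)
    (P := fun B => \int[m1]_(x in X1 @^-1` B) (f1 x)%:E =
     \int[m2]_(x in X2 @^-1` B) (f2 x)%:E)%E) => //.
- exact: RGenOInfty.measurableE.
- move=> _ _ [a ->] [b ->]; exists (Num.max a b).
  apply/seteqP; split=> t /=; rewrite !in_itv/= !andbT gt_max.
    by move=> [-> ->].
  by move=> /andP[].
- move=> _ [a ->].
  have cvg1 := cvg_integral_derive1_softplus (a := a) mX1 if1.
  have cvg2 := cvg_integral_derive1_softplus (a := a) mX2 if2.
  have <- := cvg_lim _ cvg1; last by [].
  have <- := cvg_lim _ cvg2; last by [].
  by congr (limn _); apply/funext => n; apply: f12; exact: C1_softplus.
- move=> S mS f12S.
  have split d (T : measurableType d) (m : {measure set T -> \bar R})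
      (X f : T -> R) : measurable_fun [set: T] X ->
      m.-integrable [set: T] (EFin \o f) ->
      (\int[m]_(x in X @^-1` (~` S)) (f x)%:E =
       \int[m]_x (f x)%:E - \int[m]_(x in X @^-1` S) (f x)%:E)%E.
    move=> mX If; have mXS := measurable_preimageT mX mS.
    rewrite -(setUv (X @^-1` S)) integral_setU//=; last 3 first.
    - exact: measurableC.
    - by rewrite setUv; exact: measurable_int If.
    - exact/disj_setPCl.
    rewrite [X in _ = (X - _)%E]addeC addeK//.
    have := integrable_fin_num mXS (integrableS measurableT mXS (@subsetT _ _) If).
    exact.
  by rewrite !split// total f12S.
- move=> F mF tF f12F; rewrite !preimage_bigcup !integral_bigcup//.
  + by apply: eq_eseriesr => n _; exact: f12F.
  + exact: tpre tF.
  + by move=> n; exact: measurable_preimageT.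
  + apply: integrableS if2 => //; apply: bigcup_measurable => n _; exact: measurable_preimageT.
  + exact: tpre tF.
  + by move=> n; exact: measurable_preimageT.
  + apply: integrableS if1 => //; apply: bigcup_measurable => n _; exact: measurable_preimageT.
- suff : (@RGenOInfty.G R).-sigma.-measurable B by [].
  by rewrite -RGenOInfty.measurableE.
Qed.

End weighted_laws.

(** * The kernel representing a function by its derivative *)

(** The Peano kernel of [f |-> (x - m) (f x - f m)]: for [m < x] it is [x - m] on
the half-open interval from [m] to [x], for [x < m] it is [m - x] on the one from
[x] to [m]. *)
Definition peano_kernel (R : realType) (m x t : R) : R :=
  (x - m) * ((t <= x)%R%:R - (t <= m)%R%:R).

Lemma peano_kernel_ge0 (R : realType) (m x t : R) : 0 <= peano_kernel m x t.
Proof.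
rewrite /peano_kernel; have [tx|tx] := leP t x; have [tm|tm] := leP t m.
- by rewrite subrr mulr0.
- by rewrite subr0 mulr1; lra.
- by rewrite sub0r mulrN1; lra.
- by rewrite subrr mulr0.
Qed.

Lemma peano_kernel_le (R : realType) (m x t : R) :
  peano_kernel m x t <= `|x - m|.
Proof.
rewrite -[leLHS]ger0_norm ?peano_kernel_ge0// /peano_kernel normrM ler_piMr//.
by case: (t <= x); case: (t <= m);
  rewrite ?subrr ?subr0 ?sub0r ?normrN ?normr1 ?normr0.
Qed.

Lemma measurable_peano_kernel d (T : measurableType d) (R : realType)
    (m : R) (Y Z : T -> R) :
  measurable_fun [set: T] Y -> measurable_fun [set: T] Z ->
  measurable_fun [set: T] (fun w => peano_kernel m (Y w) (Z w)).
Proof.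
move=> mY mZ; apply: measurable_funM; first exact: measurable_funB.
have mb (b : T -> bool) : measurable_fun [set: T] b ->
    measurable_fun [set: T] (fun w => (b w)%:R : R).
  move=> mb; rewrite (_ : (fun _ => _) = (fun w => if b w then 1 else 0)).
    exact: measurable_fun_ifT.
  by apply/funext => w; case: (b w).
by apply: measurable_funB; apply: mb; apply: measurable_fun_ler.
Qed.

Lemma integral_derive1_itv (R : realType) (f : R -> R) (a b : R) : a < b ->
  C1_bounded_deriv f ->
  (\int[lebesgue_measure]_t (\1_`]a, b]%classic t * derive1 f t)%:E =
   (f b - f a)%:E)%E.
Proof.
move=> ab C1f; have [df cf _] := C1f.
rewrite EFinB -(continuous_FTC2 ab (f := derive1 f)); last 3 first.
- exact: continuous_subspaceT.
- have cont x : {for x, continuous f}.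
    by apply: differentiable_continuous; exact/derivable1_diffP.
  split => [x _ //| |]; first exact/cvg_at_right_filter/cont.
  exact/cvg_at_left_filter/cont.
- by [].
rewrite -integral_itv_obnd_cbnd; last first.
  apply/measurable_EFinP/measurable_funTS; exact: measurable_derive1_C1.
under eq_integral do rewrite mulrC.
exact: (@integral_mul_indic _ (measurableTypeR R) R lebesgue_measure id).
Qed.

Lemma integral_peano_kernel (R : realType) (f : R -> R) (m x : R) :
  C1_bounded_deriv f ->
  (\int[lebesgue_measure]_t (peano_kernel m x t * derive1 f t)%:E =
   ((x - m) * (f x - f m))%:E)%E.
Proof.
move=> C1f.
have intK (a b c : R) : a < b ->
    (\int[lebesgue_measure]_t (c * (\1_`]a, b]%classic t * derive1 f t))%:E =
     (c * (f b - f a))%:E)%E.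
  move=> ab; under eq_integral do rewrite EFinM.
  rewrite integralZl// ?integral_derive1_itv//.
  have C1f' := C1f; case: C1f' => _ cf _.
  rewrite (_ : (fun _ => _) = (EFin \o derive1 f) \_ `]a, b]%classic).
    apply/(integrable_mkcond _ _).1 => //.
    have fab : lebesgue_measure.-integrable `[a, b] (EFin \o derive1 f).
      apply: continuous_compact_integrable; first exact: segment_compact.
      exact: continuous_subspaceT.
    by apply: integrableS fab => //; exact: subset_itv_oc_cc.
  apply/funext => t; rewrite patchE /=; case: ifPn => [tab|tab].
    by rewrite indicE tab mul1r.
  by rewrite indicE (negbTE tab) mul0r.
(* In either order of [m] and [x] the kernel is a multiple of an indicator. *)
have [mx|xm|->] := ltgtP m x.
- rewrite -intK//; apply: eq_integral => t _; congr EFin.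
  rewrite -mulrA; congr (_ * (_ * _)); rewrite indicE.
  have [tm|tm] := leP t m; have [tx|tx] := leP t x.
  + by rewrite subrr memNset//= in_itv/= ltNge tm.
  + by move: (lt_trans mx tx); rewrite ltNge tm.
  + by rewrite subr0 mem_set//= in_itv/= tm tx.
  + by rewrite subrr memNset//= in_itv/= leNgt tx andbF.
- rewrite -[in RHS]mulrNN opprB opprB -intK//.
  apply: eq_integral => t _; congr EFin.
  rewrite -mulrA -(opprB x m) mulNr -mulrN -mulNr; congr (_ * (_ * _)).
  rewrite indicE.
  have [tm|tm] := leP t m; have [tx|tx] := leP t x.
  + by rewrite subrr memNset ?oppr0//= in_itv/= ltNge tx.
  + by rewrite sub0r mem_set//= in_itv/= tm tx.
  + by move: (lt_le_trans tm tx); rewrite ltNge (ltW xm).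
  + by rewrite subrr memNset ?oppr0//= in_itv/= leNgt tm andbF.
- rewrite subrr mul0r; apply: integral0_eq => t _.
  by rewrite /peano_kernel subrr !mul0r.
Qed.

Lemma integral_peano_kernel_sqr (R : realType) (m x : R) :
  (\int[lebesgue_measure]_t (peano_kernel m x t)%:E = ((x - m) ^+ 2)%:E)%E.
Proof.
rewrite expr2 -(integral_peano_kernel m x (@C1_id R)).
by apply: eq_integral => t _; rewrite derive1_id mulr1.
Qed.

(** * Densities *)

Lemma exists_probability_of_density d (T : measurableType d) (R : realType)
    (mu : {measure set T -> \bar R}) (f : T -> R) :
  mu.-integrable [set: T] (EFin \o f) -> (forall x, 0 <= f x) ->
  (\int[mu]_x (f x)%:E = 1)%E ->
  exists nu : probability T R,
    forall B, measurable B -> nu B = (\int[mu]_(x in B) (f x)%:E)%E.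
Proof.
move=> If f0 f1; pose nu B := (\int[mu]_(x in B) (f x)%:E)%E.
have nu0 : nu set0 = 0%E by rewrite /nu integral_set0.
have nu_ge0 B : (0 <= nu B)%E.
  by rewrite /nu integral_ge0// => x _; rewrite lee_fin.
have nu_sigma : semi_sigma_additive nu.
  move=> A mA tA mUA; rewrite /nu integral_bigcup//; last first.
    by apply: integrableS If.
  apply: is_cvg_ereal_nneg_natsum_cond => n _ _.
  by apply: integral_ge0 => x _; rewrite lee_fin.
pose nu_measure := isMeasure.Build _ _ _ nu nu0 nu_ge0 nu_sigma.
pose nu' : {measure set T -> \bar R} := HB.pack nu nu_measure.
have nu'1 : nu' [set: T] = 1%E by [].
pose nu_prob := Measure_isProbability.Build _ _ _ nu' nu'1.
pose nu'' : probability T R := HB.pack nu nu_measure nu_prob.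
by exists nu''.
Qed.

(** The Radon-Nikodym theorem, for a measure on the Borel sets of [R] that has first
to be repackaged on the measurable space carrying the Lebesgue measure. *)
Lemma exists_Lebesgue_density (R : realType) (nu : {measure set R -> \bar R}) :
  (nu [set: R] < +oo)%E -> nu `<< (@lebesgue_measure R) ->
  exists p : R -> R, is_density (@lebesgue_measure R) nu p.
Proof.
move=> nufin nul; pose nu' : set (measurableTypeR R) -> \bar R := nu.
have nu'_ge0 B : (0 <= nu' B)%E by exact: measure_ge0.
have nu'_sigma : semi_sigma_additive nu'.
  exact: (@measure_semi_sigma_additive _ _ _ nu).
pose nu_measure := isMeasure.Build _ _ _ nu' (measure0 nu) nu'_ge0 nu'_sigma.
pose nu_m : {measure set (measurableTypeR R) -> \bar R} := HB.pack nu' nu_measure.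
have nu_fin : fin_num_fun nu_m by exact: lty_fin_num_fun.
pose nu_finite := Measure_isFinite.Build _ _ _ nu_m nu_fin.
pose nu_f : {finite_measure set (measurableTypeR R) -> \bar R} :=
  HB.pack nu' nu_measure nu_finite.
have [p [p0 pfin Ip pE]] := @radon_nikodym_sigma_finite _ _ _
  (@lebesgue_measure R) nu_f nul.
have pK x : (fine (p x))%:E = p x by rewrite fineK.
exists (fine \o p); split.
- apply/measurable_EFinP; rewrite (_ : _ \o _ = p); first exact: measurable_int Ip.
  by apply/funext => x; exact: pK.
- by move=> x; exact: fine_ge0.
- move=> B mB; rewrite [LHS](pE _ mB).
  by apply: eq_integral => x _; rewrite [RHS]pK.
Qed.

(** * The Stein identity for a square integrable variable *)

Section second_moment.
Context d (Omega : measurableType d) (R : realType) (P : probability Omega R).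
Variable X : {RV P >-> R}.
Hypothesis EX2 : ('E_P[fun w => (X w ^+ 2)%R] < +oo)%E.

Local Notation m := (mean X).
Local Notation lambda := (@lebesgue_measure R).

(** The function [E[(X - m) 1{X >= t}]] of [t], that is [var X] times the density
of the non-zero biased law; taking the mean of a nonnegative kernel makes its sign
and its measurability immediate. *)
Definition mean_kernel (t : R) : R :=
  fine (\int[P]_w (peano_kernel m (X w) t)%:E)%E.

Let mX : measurable_fun [set: Omega] X. Proof. exact: measurable_funPT. Qed.

Lemma integrable_sqrB c :
  P.-integrable [set: Omega] (EFin \o (fun w => (X w - c) ^+ 2)).
Proof.
have iX2 : P.-integrable [set: Omega] (EFin \o (fun w => X w ^+ 2)).
  apply/integrableP; split.
    by apply/measurable_EFinP; exact: measurable_funX.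
  move: EX2; rewrite unlock; apply: le_lt_trans.
  by under eq_integral do rewrite gee0_abs ?lee_fin ?sqr_ge0//.
apply: (@le_integrable _ _ _ P setT measurableT _
  (EFin \o (fun w => 2 * X w ^+ 2 + 2 * c ^+ 2))).
- by apply/measurable_EFinP; apply: measurable_funX; exact: measurable_funB.
- move=> w _ /=; rewrite lee_fin ger0_norm ?sqr_ge0// ger0_norm.
    have := sqr_ge0 (X w + c); rewrite !expr2; lra.
  by rewrite addr_ge0// mulr_ge0// sqr_ge0.
- rewrite (_ : _ \o _ = (fun w => 2%:E * (X w ^+ 2)%:E) \+ cst (2 * c ^+ 2)%:E)%E//.
  apply: integrableD => //; first exact: integrableZl.
  exact: finite_measure_integrable_cst.
Qed.

Lemma integrableB_cst c : P.-integrable [set: Omega] (EFin \o (fun w => X w - c)).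
Proof.
apply: (@le_integrable _ _ _ P setT measurableT _
  (EFin \o (fun w => (X w - c) ^+ 2 + 1))).
- by apply/measurable_EFinP; exact: measurable_funB.
- move=> w _ /=; rewrite lee_fin (@ger0_norm _ (_ + 1)) ?addr_ge0 ?sqr_ge0//.
  rewrite ler_norml.
  have := sqr_ge0 (X w - c + 1); have := sqr_ge0 (X w - c - 1).
  have := sqr_ge0 (X w - c); move: (X w - c) => y; rewrite !expr2; lra.
- rewrite (_ : _ \o _ = (EFin \o (fun w => (X w - c)%R ^+ 2)%R) \+ cst 1%:E)%E//.
  apply: integrableD => //; first exact: integrable_sqrB.
  exact: finite_measure_integrable_cst.
Qed.

Lemma expectation_centered : (\int[P]_w (X w - m)%:E = 0)%E.
Proof.
have iX : P.-integrable [set: Omega] (EFin \o X).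
  have := integrableB_cst 0; congr (_.-integrable _ _).
  by apply/funext => w /=; rewrite subr0.
under eq_integral do rewrite EFinB.
rewrite integralB//; last exact: finite_measure_integrable_cst.
have P1 := @probability_setT _ _ _ P.
rewrite integral_cst// [X in (_ - _ * X)%E]P1 mule1 /mean unlock fineK ?subee//;
  exact: integrable_fin_num.
Qed.

Lemma varE : ((var X)%:E = \int[P]_w ((X w - m) ^+ 2)%:E)%E.
Proof.
have -> : var X = fine ('E_P[fun w => ((X w - m) ^+ 2)%R])%E.
  by rewrite /var /variance covariance.unlock.
rewrite unlock.
by rewrite fineK//; exact: integrable_fin_num (integrable_sqrB m).
Qed.

Lemma integrable_peano_kernel t :
  P.-integrable [set: Omega] (EFin \o (fun w => peano_kernel m (X w) t)).
Proof.
apply: le_integrable (integrableB_cst m) => //.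
  by apply/measurable_EFinP; apply: measurable_peano_kernel.
move=> w _ /=; rewrite lee_fin ger0_norm ?peano_kernel_ge0//.
exact: peano_kernel_le.
Qed.

Lemma mean_kernelE t :
  ((mean_kernel t)%:E = \int[P]_w (peano_kernel m (X w) t)%:E)%E.
Proof.
rewrite fineK//; exact: integrable_fin_num (integrable_peano_kernel t).
Qed.

Lemma mean_kernel_ge0 t : 0 <= mean_kernel t.
Proof.
rewrite -lee_fin mean_kernelE integral_ge0// => w _.
by rewrite lee_fin peano_kernel_ge0.
Qed.

(** The kernel is [(X - m) 1{X >= t}] minus a constant multiple of the centered
variable [X - m]. *)
Lemma nzb_densityE t : nzb_density X t = (var X)^-1 * mean_kernel t.
Proof.
rewrite /nzb_density; congr (_ * fine _).
rewrite unlock.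
have -> : (\int[P]_w (peano_kernel m (X w) t)%:E =
    \int[P]_w (((X w - m) * \1_[set w' | t <= X w'] w)%:E -
       (t <= m)%R%:R%:E * (X w - m)%:E))%E.
  apply: eq_integral => w _; rewrite -EFinM -EFinB; congr EFin.
  rewrite /peano_kernel indicE.
  have [tX|tX] := leP t (X w).
    by rewrite mem_set//; ring.
  by rewrite memNset/= ?leNgt ?tX//; ring.
rewrite integralB//.
- rewrite integralZl ?expectation_centered ?mule0 ?sube0//.
  exact: (integrableB_cst m).
- have mt : measurable [set w' | t <= X w'].
    have := measurable_preimageT mX (measurable_itv `[t, +oo[).
    by congr measurable; apply/seteqP; split=> w /=; rewrite in_itv/= andbT.
  apply: le_integrable (integrableB_cst m) => //.
    apply/measurable_EFinP; apply: measurable_funM => //.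
    exact: measurable_funB.
  move=> w _ /=; rewrite lee_fin normrM ler_piMr//.
  by rewrite indicE; case: (_ \in _); rewrite ?normr1 ?normr0.
- exact/integrableZl/(integrableB_cst m).
Qed.

Lemma measurable_mean_kernel : measurable_fun [set: R] mean_kernel.
Proof.
apply/measurable_EFinP.
rewrite (_ : _ \o _ = (fun t => \int[P]_w (peano_kernel m (X w) t)%:E)%E).
  apply: (measurable_fun_fubini_tonelli_G (m1 := P) (T2 := measurableTypeR R)
    (fun wt => (peano_kernel m (X wt.1) wt.2)%:E)).
    apply/measurable_EFinP; apply: measurable_peano_kernel.
      exact: measurableT_comp.
    exact: measurable_snd.
  by move=> wt; rewrite lee_fin peano_kernel_ge0.
by apply/funext => t; exact: mean_kernelE.
Qed.

(** The double integral of the absolute value is at most [M * var X], because the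
kernel integrates to [(X - m) ^+ 2] in [t]. *)
Lemma integrable_peano_kernelM (phi : R -> R) (M : R) :
  measurable_fun [set: R] phi -> (forall t, `|phi t| <= M) ->
  (P \x lambda)%E.-integrable setT
    (fun wt => (peano_kernel m (X wt.1) wt.2 * phi wt.2)%:E).
Proof.
move=> mphi phiM.
have mK : measurable_fun setT (fun wt : Omega * measurableTypeR R =>
    peano_kernel m (X wt.1) wt.2).
  apply: measurable_peano_kernel; first exact: measurableT_comp.
  exact: measurable_snd.
apply/integrable12ltyP.
  apply/measurable_EFinP; apply: measurable_funM => //.
  by apply: measurableT_comp => //; exact: measurable_snd.
apply: (@le_lt_trans _ _ (\int[P]_w (M * (X w - m) ^+ 2)%:E)%E); last first.
  under eq_integral do rewrite EFinM.
  rewrite integralZl//; last exact: integrable_sqrB.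
  by rewrite -varE -EFinM ltry.
have mKF : measurable_fun setT (fun wt : Omega * measurableTypeR R =>
    `|(peano_kernel m (X wt.1) wt.2 * phi wt.2)%:E|)%E.
  apply: measurableT_comp => //; apply/measurable_EFinP; apply: measurable_funM => //.
  by apply: measurableT_comp => //; exact: measurable_snd.
apply: ge0_le_integral => //.
- by move=> w _; exact: integral_ge0.
- exact: (measurable_fun_fubini_tonelli_F (fun wt : Omega * measurableTypeR R =>
    `|(peano_kernel m (X wt.1) wt.2 * phi wt.2)%:E|%E)).
- apply/measurable_EFinP; apply: measurable_funM => //.
  by apply: measurable_funX; exact: measurable_funB.
- move=> w _.
  have -> : (M * (X w - m) ^+ 2)%:E =
      (\int[lambda]_t (M * peano_kernel m (X w) t)%:E)%E.
    under eq_integral do rewrite EFinM.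
    have M0 : 0 <= M by exact: le_trans (phiM 0).
    rewrite ge0_integralZl//.
    - by rewrite integral_peano_kernel_sqr -EFinM.
    - apply/measurable_EFinP; apply: measurable_peano_kernel => //.
    - by move=> t _; rewrite lee_fin peano_kernel_ge0.
  apply: ge0_le_integral => //.
  - apply: measurableT_comp => //; apply/measurable_EFinP.
    by apply: measurable_funM => /=; [exact: measurable_peano_kernel|exact: mphi].
  - apply/measurable_EFinP.
    by apply: measurable_funM; [exact: measurable_cst|exact: measurable_peano_kernel].
  - move=> t _; rewrite lee_fin normrM ger0_norm ?peano_kernel_ge0// mulrC.
    by rewrite ler_wpM2r ?peano_kernel_ge0.
Qed.

Lemma integral_mean_kernel1 :
  (\int[lambda]_t (mean_kernel t)%:E = (var X)%:E)%E.
Proof.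
have mK : measurable_fun setT (fun wt : Omega * measurableTypeR R =>
    (peano_kernel m (X wt.1) wt.2)%:E).
  apply/measurable_EFinP; apply: measurable_peano_kernel.
    exact: measurableT_comp.
  exact: measurable_snd.
under eq_integral do rewrite mean_kernelE.
have := fubini_tonelli (m1 := P) (m2 := lambda) _ mK.
move=> /= <-; last by move=> wt; rewrite lee_fin peano_kernel_ge0.
rewrite varE; apply: eq_integral => w _.
exact: integral_peano_kernel_sqr.
Qed.

Lemma integrable_mean_kernel : lambda.-integrable setT (EFin \o mean_kernel).
Proof.
apply/integrableP; split.
  by apply/measurable_EFinP; exact: measurable_mean_kernel.
under eq_integral do rewrite gee0_abs ?lee_fin ?mean_kernel_ge0//.
by rewrite integral_mean_kernel1 ltry.
Qed.

Lemma integrable_mean_kernelM (phi : R -> R) (M : R) :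
  measurable_fun [set: R] phi -> (forall t, `|phi t| <= M) ->
  lambda.-integrable setT (fun t => (mean_kernel t * phi t)%:E).
Proof.
move=> mphi phiM.
have iM : lambda.-integrable setT (fun t => M%:E * (mean_kernel t)%:E)%E.
  exact/integrableZl/integrable_mean_kernel.
apply: le_integrable iM => //.
  apply/measurable_EFinP; apply: measurable_funM => //.
  exact: measurable_mean_kernel.
move=> t _ /=; rewrite lee_fin normrM mulrC normrM ler_wpM2r//.
by rewrite (le_trans (phiM t))// ler_norm.
Qed.

(** Fubini's theorem for the kernel times [f'], in one order by
[integral_peano_kernel] and in the other by the definition of [mean_kernel]. The
constant [f m] is harmless because [X - m] is centered. *)
Lemma integral_mean_kernel (f : R -> R) : C1_bounded_deriv f ->
  [/\ lambda.-integrable setT (fun t => (mean_kernel t * derive1 f t)%:E),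
      P.-integrable setT (fun w => ((X w - m) * f (X w))%:E)
    & (\int[P]_w ((X w - m) * f (X w))%:E =
       \int[lambda]_t (mean_kernel t * derive1 f t)%:E)%E].
Proof.
move=> C1f; have mf := measurable_derive1_C1 C1f; have [_ _ [M fM]] := C1f.
have intF := integrable_peano_kernelM mf fM.
set F := (fun wt => _) in intF.
have GE : fubini_G P F = fun t => (mean_kernel t * derive1 f t)%:E.
  apply/funext => t; rewrite [RHS]EFinM mean_kernelE muleC.
  rewrite -integralZl; [|by []|exact: integrable_peano_kernel].
  by apply: eq_integral => w _; rewrite /F/= mulrC EFinM.
have FE : fubini_F lambda F = fun w => ((X w - m) * (f (X w) - f m))%:E.
  by apply/funext => w; rewrite /fubini_F /F /= integral_peano_kernel.
have iF : P.-integrable setT (fun w => ((X w - m) * (f (X w) - f m))%:E).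
  by rewrite -FE; exact: integrable_fubini_F.
have ifm : P.-integrable setT (fun w => (f m)%:E * (X w - m)%:E)%E.
  exact/integrableZl/(integrableB_cst m).
have fE w : (((X w - m) * f (X w))%:E =
    ((X w - m) * (f (X w) - f m))%:E + (f m)%:E * (X w - m)%:E)%E.
  by rewrite -EFinM -EFinD; congr EFin; ring.
split.
- exact: integrable_mean_kernelM fM.
- by rewrite (funext fE); exact: integrableD.
- under eq_integral do rewrite fE.
  rewrite integralD// integralZl//; last exact: integrableB_cst.
  rewrite expectation_centered mule0 adde0 -FE -GE.
  exact: Fubini.
Qed.

Hypothesis ndX : nondegenerate_RV X.

Lemma var_gt0 : 0 < var X.
Proof.
have mXm : measurable (X @^-1` [set~ m]).
  by apply: measurable_preimageT => //; exact: measurableC.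
have PXm : P (X @^-1` [set~ m]) != 0%E.
  apply/eqP => PX0; apply: (ndX (c := m)).
  have -> : [set w | X w = m] = ~` (X @^-1` [set~ m]).
    by apply/seteqP; split=> w /=; rewrite notK.
  by rewrite probability_setC// PX0 sube0.
have V_ge0 : (0 <= \int[P]_w ((X w - m) ^+ 2)%:E)%E.
  by apply: integral_ge0 => w _; rewrite lee_fin sqr_ge0.
suff : (0 < (var X)%:E)%E by rewrite lte_fin.
rewrite varE lt_neqAle V_ge0 andbT.
apply: contra PXm => /eqP V0; apply/eqP.
apply: (@integral_gt0_null _ _ _ _ _ (fun w => (X w - m) ^+ 2)) => //.
- by apply: measurable_funTS; apply: measurable_funX; exact: measurable_funB.
- by move=> w /= /eqP Xm; rewrite exprn_even_gt0//= subr_eq0.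
- rewrite [leRHS]V0.
  apply: ge0_subset_integral => //.
    by apply/measurable_EFinP; apply: measurable_funX; exact: measurable_funB.
  by move=> w _; rewrite lee_fin sqr_ge0.
Qed.

(** A nonnegative variable of mean 0 vanishes almost surely. For the kernel at
[t <= m] this says that [X >= t] almost surely, and for [t > m] that [X < t]
almost surely; both are excluded when [t] is strictly between the essential
bounds. *)
Lemma mean_kernel_gt0 t : ess_interval X t -> 0 < mean_kernel t.
Proof.
move=> [] /andP[It1 It2]; rewrite lt_neqAle mean_kernel_ge0 andbT.
apply/negP => /eqP g0.
have K0 : {ae P, forall w, peano_kernel m (X w) t = 0}.
  have : (\int[P]_w `|(peano_kernel m (X w) t)%:E| = 0)%E.
    under eq_integral do rewrite gee0_abs ?lee_fin ?peano_kernel_ge0//.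
    by rewrite -mean_kernelE -g0.
  move/ae_eq_integral_abs => /(_ measurableT) /(_ _)[].
    by apply/measurable_EFinP; apply: measurable_peano_kernel.
  move=> N [mN N0 DN]; exists N; split=> // w /= Kw; apply: DN => /=.
  by move=> /(_ Logic.I) [].
have [tm|mt] := leP t m.
- move: It1; rewrite ltNge => /negP; apply; apply/ess_infP.
  apply: filterS K0 => w /=; rewrite lee_fin /peano_kernel tm.
  have [//|Xt] := leP t (X w).
  move=> Kw; exfalso; move: Kw; rewrite sub0r mulrN1; lra.
- move: It2; rewrite ltNge => /negP; apply; apply/ess_supP.
  apply: filterS K0 => w /=; rewrite lee_fin /peano_kernel (leNgt t m) mt/=.
  have [tX|/ltW//] := leP t (X w).
  move=> Kw; exfalso; move: Kw; rewrite subr0 mulr1; lra.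
Qed.

(** If [X >= t] almost surely, or [X < t] almost surely, the kernel at [t] is almost
surely a constant multiple of the centered variable [X - m]. The upper essential
bound has to be excluded: [X] may have an atom there. *)
Lemma mean_kernel_eq0 t : ~ ess_interval X t -> t <> fine (ess_supr P X) ->
  mean_kernel t = 0.
Proof.
move=> nIt tb.
(* [c] is the almost sure value of the indicator of [X >= t]. *)
have const (c : R) : {ae P, forall w, (t <= X w)%R%:R = c} -> mean_kernel t = 0.
  move=> Hc; apply/EFin_inj; rewrite mean_kernelE.
  transitivity (\int[P]_w ((c - (t <= m)%R%:R)%:E * (X w - m)%:E))%E; last first.
    by rewrite integralZl ?expectation_centered ?mule0//; exact: integrableB_cst.
  apply: ae_eq_integral => //.
  - by apply/measurable_EFinP; apply: measurable_peano_kernel.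
  - by apply/measurable_EFinP; apply: measurable_funM => //; exact: measurable_funB.
  - apply: filterS Hc => w /= <- _; by rewrite -EFinM mulrC.
have [ta|ta] := leP t%:E (ess_infr P X).
  by apply: (const 1); move/ess_infP : ta; apply: filterS => w /=; rewrite lee_fin => ->.
have [tb'|bt] := ltP t%:E (ess_supr P X).
  by exfalso; apply: nIt; rewrite /ess_interval/= ta tb'.
have {bt} bt : (ess_supr P X < t%:E)%E.
  rewrite lt_neqAle bt andbT; apply/eqP => tE; apply: tb; by rewrite tE.
apply: (const 0).
have := @ess_sup_ge _ _ _ P (EFin \o X).
apply: filterS => w /= Xb; rewrite leNgt.
by have := le_lt_trans Xb bt; rewrite lte_fin => ->.
Qed.

Lemma measurable_ess_interval : measurable (ess_interval X).
Proof.
rewrite (_ : ess_interval X =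
    EFin @^-1` [set` `]ess_infr P X, ess_supr P X[]).
  apply: measurable_preimageT; last exact: emeasurable_itv.
  exact/measurable_EFinP.
by apply/seteqP; split=> t; rewrite /ess_interval/= in_itv.
Qed.

Lemma closure_ess_interval t : closure (ess_interval X) t -> ~ ess_interval X t ->
  t = fine (ess_infr P X) \/ t = fine (ess_supr P X).
Proof.
move=> cIt nIt.
have cEFin : continuous (@EFin R).
  by move=> x; apply: cvg_EFin; [exact: nearW|exact: cvg_id].
have clos B : closed B -> ess_interval X `<=` B -> B t.
  by move=> cB /closure_subset /(_ _ cIt); rewrite -(closure_id B).1.
have a_le : (ess_infr P X <= t%:E)%E.
  apply: (clos (EFin @^-1` [set y | ess_infr P X <= y]%E)).
    by apply: preimage_closed => [x _|]; [exact: cEFin|exact: closed_ereal_le_ereal].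
  by move=> s /andP[/ltW].
have le_b : (t%:E <= ess_supr P X)%E.
  apply: (clos (EFin @^-1` [set y | y <= ess_supr P X]%E)).
    by apply: preimage_closed => [x _|]; [exact: cEFin|exact: closed_ereal_ge_ereal].
  by move=> s /andP[_ /ltW].
move: a_le; rewrite le_eqVlt => /predU1P[->|a_lt]; first by left.
move: le_b; rewrite le_eqVlt => /predU1P[<-|lt_b]; first by right.
by exfalso; apply: nIt; rewrite /ess_interval/= a_lt lt_b.
Qed.

Let measurable_idR : measurable_fun [set: measurableTypeR R] (@id R).
Proof. exact: measurable_id. Qed.

Lemma Stein_kernel_law (tau : R -> R) : is_Stein_kernel X tau ->
  P.-integrable setT (EFin \o (tau \o X)) /\
  same_weighted_law P X (tau \o X) lambda id mean_kernel.
Proof.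
move=> [mtau tauS].
have Itau : P.-integrable setT (EFin \o (tau \o X)).
  have [+ _ _] := tauS _ (@C1_id R); congr (_.-integrable _ _).
  by apply/funext => w /=; rewrite derive1_id mulr1.
split=> //; apply: same_weighted_law_of_C1 => //.
- exact: integrable_mean_kernel.
- move=> f C1f; have [_ _] := tauS _ C1f; rewrite unlock => ->.
  by have [_ _ ->] := integral_mean_kernel C1f.
Qed.

(** Nonnegativity makes the integrability of [tau] a consequence of the equality of
the total masses. *)
Lemma Stein_kernel_of_law (tau : R -> R) : measurable_fun [set: R] tau ->
  (forall t, 0 <= tau t) ->
  same_weighted_law P X (tau \o X) lambda id mean_kernel ->
  is_Stein_kernel X tau.
Proof.
move=> mtau tau0 law; split=> // f C1f.
have mtauX : measurable_fun [set: Omega] (tau \o X) by exact: measurableT_comp.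
have mf := measurable_derive1_C1 C1f; have [_ _ [M fM]] := C1f.
have [If' IXf Xff'] := integral_mean_kernel C1f.
have Itau : P.-integrable setT (EFin \o (tau \o X)).
  apply/integrableP; split; first exact/measurable_EFinP.
  under eq_integral do rewrite gee0_abs ?lee_fin ?tau0//.
  have := law setT measurableT; rewrite !preimage_setT => ->.
  by rewrite integral_mean_kernel1 ltry.
split=> //.
- have ItauM : P.-integrable setT (fun w => M%:E * (tau (X w))%:E)%E.
    exact: integrableZl.
  apply: le_integrable ItauM => //.
    apply/measurable_EFinP; apply: measurable_funM => //.
    exact: measurableT_comp.
  move=> w _ /=; rewrite lee_fin normrM mulrC normrM ler_wpM2r//.
  by rewrite (le_trans (fM _))// ler_norm.
- rewrite unlock Xff'.
  apply: (same_weighted_law_integral (phi := derive1 f) mX measurable_idR mtauX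
    measurable_mean_kernel) => //.
    by move=> w; exact: tau0.
  exact: mean_kernel_ge0.
Qed.

Lemma nonzero_biased_law (nu : probability (measurableTypeR R) R) :
  is_nonzero_biased X nu ->
  same_weighted_law nu id (cst (var X)) lambda id mean_kernel.
Proof.
move=> nuX; apply: same_weighted_law_of_C1 => //.
- exact: finite_measure_integrable_cst.
- exact: integrable_mean_kernel.
- move=> f C1f; have [_ _ <-] := integral_mean_kernel C1f.
  have := nuX _ C1f; rewrite unlock => <-.
  under eq_integral do rewrite EFinM.
  have [_ _ [M fM]] := C1f.
  rewrite integralZl//; apply: (@le_integrable _ _ _ nu setT measurableT _
    (EFin \o cst M)).
  + by apply/measurable_EFinP; exact: measurable_derive1_C1.
  + by move=> t _ /=; rewrite lee_fin (le_trans (fM t))// ler_norm.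
  + exact: finite_measure_integrable_cst.
Qed.

Lemma nzb_density_ge0 t : 0 <= nzb_density X t.
Proof.
by rewrite nzb_densityE mulr_ge0 ?mean_kernel_ge0// invr_ge0 ltW ?var_gt0.
Qed.

Lemma measurable_nzb_density : measurable_fun [set: R] (nzb_density X).
Proof.
rewrite (funext nzb_densityE); apply: measurable_funM => //.
exact: measurable_mean_kernel.
Qed.

Lemma varM_nzb_density t : var X * nzb_density X t = mean_kernel t.
Proof. by rewrite nzb_densityE mulrA divff ?mul1r// gt_eqF ?var_gt0. Qed.

Lemma integral_nzb_density (B : set R) : measurable B ->
  (\int[lambda]_(t in B) (nzb_density X t)%:E =
   (var X)^-1%:E * \int[lambda]_(t in B) (mean_kernel t)%:E)%E.
Proof.
move=> mB; under eq_integral do rewrite nzb_densityE EFinM.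
rewrite ge0_integralZl//.
- by apply/measurable_EFinP/measurable_funTS; exact: measurable_mean_kernel.
- by move=> t _; rewrite lee_fin mean_kernel_ge0.
- by rewrite lee_fin invr_ge0 ltW ?var_gt0.
Qed.

Lemma exists_nonzero_biased :
  exists nu : probability (measurableTypeR R) R, is_nonzero_biased X nu.
Proof.
have Iq : lambda.-integrable setT (EFin \o nzb_density X).
  rewrite (_ : _ \o _ = (fun t => (var X)^-1%:E * (mean_kernel t)%:E)%E).
    exact/integrableZl/integrable_mean_kernel.
  by apply/funext => t /=; rewrite nzb_densityE.
have [|nu nuE] := exists_probability_of_density Iq nzb_density_ge0.
  rewrite integral_nzb_density// integral_mean_kernel1 -EFinM mulVf//.
  by rewrite gt_eqF ?var_gt0.
exists nu => f C1f; have [_ _ ] := integral_mean_kernel C1f.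
rewrite unlock => ->; have mf := measurable_derive1_C1 C1f.
have law : same_weighted_law nu id (cst 1) lambda id (nzb_density X).
  move=> B mB; transitivity (1%:E * nu B)%E; last by rewrite mul1e; exact: nuE.
  exact: (@integral_cst _ (measurableTypeR R) R nu B mB 1%:E).
have := same_weighted_law_integral (phi := derive1 f) measurable_idR measurable_idR
  (measurable_cst _) measurable_nzb_density (fun=> ler01) nzb_density_ge0 mf law.
under eq_integral do rewrite mul1r.
move=> ->; rewrite -integralZl//; last first.
  have [_ _ [M fM]] := C1f.
  have := integrable_mean_kernelM mf fM => /(integrableZl measurableT (var X)^-1).
  congr (_.-integrable _ _); apply/funext => t.
  by rewrite nzb_densityE -EFinM mulrA.
by apply: eq_integral => t _; rewrite -EFinM mulrA varM_nzb_density.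
Qed.

Lemma nonzero_biased_density (nu : probability (measurableTypeR R) R) :
  is_nonzero_biased X nu -> is_density lambda nu (nzb_density X).
Proof.
move=> /nonzero_biased_law law; split.
- exact: measurable_nzb_density.
- exact: nzb_density_ge0.
- move=> B mB; have nuB : ((var X)%:E * nu B = \int[lambda]_(t in B) (mean_kernel t)%:E)%E.
    rewrite -[RHS](law B mB); apply/esym.
    exact: (@integral_cst _ (measurableTypeR R) R nu B mB (var X)%:E).
  rewrite integral_nzb_density// -nuB muleA -EFinM mulVf ?mul1e//.
  by rewrite gt_eqF ?var_gt0.
Qed.

(** * Properties of Stein kernels *)

(** The signed measure with density [tau] with respect to the law of [X] equals the
absolutely continuous one with density [mean_kernel], so it vanishes on every
Borel subset of a Lebesgue null set. *)
Lemma Stein_kernel_null (tau : R -> R) (B : set R) : is_Stein_kernel X tau ->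
  measurable B -> lambda B = 0%E ->
  P (X @^-1` (B `&` [set t | tau t != 0])) = 0%E.
Proof.
move=> tauS mB B0; have [Itau law] := Stein_kernel_law tauS.
have mtau : measurable_fun [set: R] tau by case: tauS.
have mtauX : measurable_fun [set: Omega] (tau \o X) by exact: measurableT_comp.
have mXA (A : set R) : measurable A -> measurable (X @^-1` A).
  exact: measurable_preimageT.
have int0 (A : set R) : measurable A -> A `<=` B ->
    (\int[P]_(w in X @^-1` A) (tau (X w))%:E = 0)%E.
  move=> mA AB; rewrite (law _ mA).
  apply: null_set_integral => //.
  + by apply/measurable_EFinP/measurable_funTS; exact: measurable_mean_kernel.
  + by apply/eqP; rewrite eq_le measure_ge0 andbT -B0 le_measure// inE.
have mpos : measurable (B `&` [set t | 0 < tau t]).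
  rewrite (_ : [set t | _] = tau @^-1` `]0, +oo[).
    by apply: measurableI => //; exact: measurable_preimageT.
  by apply/seteqP; split=> t /=; rewrite in_itv/= andbT.
have mneg : measurable (B `&` [set t | tau t < 0]).
  rewrite (_ : [set t | _] = tau @^-1` `]-oo, 0[).
    by apply: measurableI => //; exact: measurable_preimageT.
  by apply/seteqP; split=> t /=; rewrite in_itv/=.
have -> : B `&` [set t | tau t != 0] =
    (B `&` [set t | 0 < tau t]) `|` (B `&` [set t | tau t < 0]).
  rewrite -setIUr; congr (_ `&` _); apply/seteqP; split=> t /=; rewrite neq_lt.
    by move=> /orP[]; [right|left].
  by move=> []->; rewrite ?orbT.
rewrite preimage_setU null_set_setU//; try exact: mXA.
- apply: (@integral_gt0_null _ _ _ _ _ (tau \o X)); first exact: mXA.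
  + exact: measurable_funTS.
  + by move=> w [].
  + by rewrite int0// => t [].
- apply: (@integral_gt0_null _ _ _ _ _ (\- (tau \o X))%R); first exact: mXA.
  + by apply: measurable_funTS; exact: measurableT_comp.
  + by move=> w [] _ /=; rewrite oppr_gt0.
  + under eq_integral do rewrite EFinN.
    rewrite integralN/=.
      by rewrite int0 ?oppe0// => t [].
    apply: integrable_add_def; first exact: mXA.
    exact: (integrableS measurableT (mXA _ mneg) (@subsetT _ _) Itau).
Qed.

Lemma Stein_kernel_unique (tau tau' : R -> R) :
  is_Stein_kernel X tau -> is_Stein_kernel X tau' ->
  {ae distribution P X, forall t, tau' t = tau t}.
Proof.
move=> S S'; have [I law] := Stein_kernel_law S; have [I' law'] := Stein_kernel_law S'.
have mtau : measurable_fun [set: R] tau by case: S.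
have mtau' : measurable_fun [set: R] tau' by case: S'.
have push (f : R -> R) E : measurable_fun [set: R] f ->
    P.-integrable setT (EFin \o (f \o X)) -> measurable E ->
    (\int[distribution P X]_(t in E) (f t)%:E = \int[P]_(w in X @^-1` E) (f (X w))%:E)%E.
  move=> mf If mE; rewrite integral_pushforward//.
    exact/measurable_EFinP.
  by apply: integrableS If => //; exact: measurable_preimageT.
have : ae_eq (distribution P X) setT (EFin \o tau') (EFin \o tau).
  apply: integral_ae_eq => //.
  - by apply: integrable_pushforward => //; exact/measurable_EFinP.
  - exact/measurable_EFinP.
  - move=> E _ mE; rewrite !push//.
    exact: etrans (law' _ mE) (esym (law _ mE)).
by apply: filterS => t /= /(_ Logic.I) [].
Qed.

(** On the part [A] of the interval where [tau <= 0], the integral of the positive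
function [mean_kernel] equals that of [tau] against the law of [X], which is
nonpositive. *)
Lemma Stein_kernel_gt0 (tau : R -> R) : is_Stein_kernel X tau ->
  {ae lambda, forall t, closure (ess_interval X) t -> 0 < tau t}.
Proof.
move=> S; have [I law] := Stein_kernel_law S.
have mtau : measurable_fun [set: R] tau by case: S.
pose A := ess_interval X `&` [set t | tau t <= 0].
have mA : measurable A.
  apply: measurableI; first exact: measurable_ess_interval.
  rewrite (_ : [set t | _] = tau @^-1` `]-oo, 0]).
    exact: measurable_preimageT.
  by apply/seteqP; split=> t /=; rewrite in_itv/=.
have A0 : lambda A = 0%E.
  apply: (@integral_gt0_null _ (measurableTypeR R) R lambda A mean_kernel) => //.
  - by apply: measurable_funTS; exact: measurable_mean_kernel.
  - by move=> t [It _]; exact: mean_kernel_gt0.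
  - rewrite -[leLHS](law _ mA).
    have -> : (\int[P]_(w in X @^-1` A) (tau (X w))%:E =
        - \int[P]_(w in X @^-1` A) (- tau (X w))%:E)%E.
      rewrite -integral_ge0N; last by move=> w [_ /=]; rewrite lee_fin oppr_ge0.
      by apply: eq_integral => w _; rewrite EFinN oppeK.
    by rewrite leeNl oppe0 integral_ge0// => w [_ /=]; rewrite lee_fin oppr_ge0.
pose a := fine (ess_infr P X); pose b := fine (ess_supr P X).
have m1 (c : R) : measurable ([set c] : set (measurableTypeR R)).
  exact: measurable_set1.
have l1 (c : R) : lambda [set c] = 0%E by exact: lebesgue_measure_set1.
have mA' : @measurable _ (measurableTypeR R) A by exact: mA.
have mAa : @measurable _ (measurableTypeR R) (A `|` [set a]) by exact: measurableU.
exists (A `|` [set a] `|` [set b]); split.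
- exact: measurableU.
- have Aa0 := null_set_setU mA' (m1 a) A0 (l1 a).
  exact: (null_set_setU mAa (m1 b) Aa0 (l1 b)).
- move=> t /= /not_implyP[cIt /negP]; rewrite -leNgt => taut.
  have [It|nIt] := pselect (ess_interval X t); first by left; left.
  by have [->|->] := closure_ess_interval cIt nIt; [left; right|right].
Qed.

(** * The Lebesgue decomposition of the law *)

Variables mu_ac mu_s : {measure set R -> \bar R}.
Hypothesis decomp :
  Lebesgue_decomposition (distribution P X) lebesgue_measure mu_ac mu_s.

(** A Lebesgue null set [N] carrying the singular part, off which the law of [X] and
its absolutely continuous part agree. *)
Lemma Lebesgue_decomposition_split : exists N : set R,
  [/\ measurable N, lambda N = 0%E, mu_s (~` N) = 0%E, mu_ac N = 0%E
    & forall B, measurable B -> B `<=` ~` N -> P (X @^-1` B) = mu_ac B].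
Proof.
have [muE acl [N [mN sN lN]]] := decomp; exists N; split => //.
- apply/measure0_null_setP => //; apply: acl => A mA AN.
  apply/eqP; rewrite eq_le measure_ge0 andbT -lN.
  by apply: le_measure; rewrite ?inE.
- move=> B mB BN; rewrite [LHS]muE//.
  suff -> : mu_s B = 0%E by rewrite adde0.
  apply/eqP; rewrite eq_le measure_ge0 andbT -sN.
  by apply: le_measure; rewrite ?inE//; exact: measurableC.
Qed.

Lemma Stein_kernel_singular (tau : R -> R) : is_Stein_kernel X tau ->
  {ae mu_s, forall t, tau t = 0}.
Proof.
move=> S; have [N [mN lN sN _ _]] := Lebesgue_decomposition_split.
have [muE _ _] := decomp.
have mtau : measurable_fun [set: R] tau by case: S.
have mA : measurable (N `&` [set t | tau t != 0]).
  apply: measurableI => //.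
  rewrite (_ : [set t | _] = tau @^-1` [set~ 0]).
    by apply: measurable_preimageT => //; exact: measurableC.
  by apply/seteqP; split=> t /= /eqP.
exists (~` N `|` (N `&` [set t | tau t != 0])); split.
- by apply: measurableU => //; exact: measurableC.
- rewrite null_set_setU//; first exact: measurableC.
  apply/eqP; rewrite eq_le measure_ge0 andbT -(Stein_kernel_null S mN lN).
  by rewrite [leRHS](muE _ mA) leeDr// measure_ge0.
- move=> t /= /eqP t0; have [Nt|nNt] := pselect (N t); [by right|by left].
Qed.

(** Any density [p0] of the absolutely continuous part is positive almost everywhere
on the interval: off the null set [N] its zeros there form a set [Z] of probability
0, on which the integral of the positive function [mean_kernel] is therefore 0. It
remains to change [p0] on [Z]. *)
Lemma positive_density_of_Stein_kernel (tau : R -> R) : is_Stein_kernel X tau ->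
  exists p : R -> R, is_density lambda mu_ac p /\ forall t, ess_interval X t -> 0 < p t.
Proof.
move=> S; have [I law] := Stein_kernel_law S.
have [N [mN lN sN aN PN]] := Lebesgue_decomposition_split.
have [muE acl _] := decomp.
have mu_ac_fin : (mu_ac [set: R] < +oo)%E.
  apply: (@le_lt_trans _ _ (distribution P X [set: R])).
    by rewrite (muE _ measurableT) leeDl// measure_ge0.
  by rewrite probability_setT ltry.
have [p0 [mp0 p00 p0E]] := exists_Lebesgue_density mu_ac_fin acl.
have mI := measurable_ess_interval.
pose Z := ess_interval X `&` p0 @^-1` [set 0].
have mZ : measurable Z.
  by apply: measurableI => //; exact: measurable_preimageT.
have mZN : @measurable _ (measurableTypeR R) (Z `\` N) by exact: measurableD.
have PZN : P (X @^-1` (Z `\` N)) = 0%E.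
  rewrite PN//.
  rewrite p0E//; apply: integral0_eq => t [[_ /= ->]] _ //.
have lZN : lambda (Z `\` N) = 0%E.
  apply: (@integral_gt0_null _ (measurableTypeR R) R lambda _ mean_kernel) => //.
  - by apply: measurable_funTS; exact: measurable_mean_kernel.
  - by move=> t [[It _] _]; exact: mean_kernel_gt0.
  - rewrite -[leLHS](law _ mZN) null_set_integral//.
    + exact: measurable_preimageT.
    + apply: measurable_funTS; exact: measurable_int I.
have lZ : lambda Z = 0%E.
  apply/eqP; rewrite eq_le measure_ge0 andbT.
  have <- : lambda ((Z `\` N) `|` N) = 0%E by exact: null_set_setU.
  apply: le_measure; rewrite ?inE//; first exact: measurableU.
  by move=> t Zt; have [Nt|nNt] := pselect (N t); [right|left].
exists (fun t => if t \in Z then 1 else p0 t); split; last first.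
  move=> t It; case: ifPn => [//|/negP tZ]; rewrite lt_neqAle p00 andbT.
  by apply/eqP => p0t; apply: tZ; rewrite inE; split.
split.
- by apply: measurable_fun_ifT => //; exact: measurable_fun_mem.
- by move=> t; case: ifP.
- move=> B mB; rewrite p0E//; apply: ae_eq_integral => //.
  + by apply/measurable_EFinP/measurable_funTS.
  + apply/measurable_EFinP/measurable_funTS; apply: measurable_fun_ifT => //.
    exact: measurable_fun_mem.
  + exists Z; split => // t /= /not_implyP[Bt]; case: ifPn => //.
    by rewrite inE.
Qed.

(** With [G = mean_kernel / p] on the interval, integrating [G] against [h] times the
law of [X] is integrating it against the absolutely continuous part, hence against
[p] times the Lebesgue measure, where [p] cancels. *)
Lemma Stein_kernel_of_density (p h : R -> R) :
  is_density lambda mu_ac p -> (forall t, ess_interval X t -> 0 < p t) ->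
  is_density (distribution P X) mu_ac h ->
  is_Stein_kernel X (fun t =>
    if t \in ess_interval X then var X * (nzb_density X t / p t) * h t else 0).
Proof.
move=> [mp p0 pE] pI [mh h0 hE].
have mI := measurable_ess_interval.
have mIb : measurable_fun [set: R] (fun t => t \in ess_interval X).
  exact: measurable_fun_mem.
pose G t := if t \in ess_interval X then mean_kernel t / p t else 0.
have G0 t : 0 <= G t.
  by rewrite /G; case: ifP => // _; rewrite divr_ge0 ?mean_kernel_ge0.
have mG : measurable_fun [set: R] G.
  apply: measurable_fun_ifT => //; apply: measurable_funM.
    exact: measurable_mean_kernel.
  (* [p] is nonnegative, so that its inverse is its power of exponent -1. *)
  rewrite (_ : (fun _ => _) = (@powR R ^~ (-1)) \o p).
    by apply: measurableT_comp => //; exact: measurable_powR.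
  by apply/funext => t /=; rewrite powR_inv1.
have -> : (fun t => if t \in ess_interval X
    then var X * (nzb_density X t / p t) * h t else 0) = fun t => h t * G t.
  apply/funext => t; rewrite /G; case: ifP => _; last by rewrite mulr0.
  by rewrite mulrA varM_nzb_density mulrC.
apply: Stein_kernel_of_law.
- exact: measurable_funM.
- by move=> t; rewrite mulr_ge0.
- have mhX : measurable_fun [set: Omega] (h \o X) by exact: measurableT_comp.
  have hp : same_weighted_law P X (h \o X) lambda id p.
    move=> B mB; rewrite -[RHS](pE _ mB) hE//.
    rewrite ge0_integral_pushforward//; first exact/measurable_EFinP/measurable_funTS.
    by move=> t _; rewrite lee_fin.
  move=> B mB.
  have mGB : measurable_fun [set: R] (fun t => G t * \1_B t).
    exact: measurable_funM.
  have hG : (\int[P]_(w in X @^-1` B) (h (X w) * G (X w))%:E =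
      \int[lambda]_(t in B) (p t * G t)%:E)%E.
    rewrite -integral_mul_indic.
    rewrite -[RHS](@integral_mul_indic _ (measurableTypeR R) R lambda id).
    under eq_integral do rewrite -mulrA.
    under [RHS]eq_integral do rewrite -mulrA.
    exact: (same_weighted_law_integral mX measurable_idR mhX mp
      (fun w => h0 (X w)) p0 mGB hp).
  rewrite [LHS]hG.
  have mB' : @measurable _ (measurableTypeR R) B by exact: mB.
  apply: ae_eq_integral => //.
  + by apply/measurable_EFinP/measurable_funTS; exact: measurable_funM.
  + by apply/measurable_EFinP/measurable_funTS; exact: measurable_mean_kernel.
  + exists [set fine (ess_supr P X)]; split.
    * exact: measurable_set1.
    * exact: lebesgue_measure_set1.
    * move=> t /= /not_implyP[_]; rewrite /G; case: ifPn => [/set_mem It|/negP It].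
        by rewrite mulrC divfK// gt_eqF// pI.
      move=> GneK; apply: contrapT => tb; apply: GneK.
      rewrite mulr0 mean_kernel_eq0// => It'; apply: It; exact: mem_set.
Qed.

(** Off the set carrying the singular part the law of [X] and its absolutely
continuous part agree, and the latter does not charge that set; the indicator of
its complement is therefore a density. *)
Lemma exists_density_ac : exists h : R -> R,
  is_density (distribution P X) mu_ac h.
Proof.
have [N [mN lN sN aN PN]] := Lebesgue_decomposition_split.
exists \1_(~` N); split.
- by apply: measurable_indic; exact: measurableC.
- by move=> t; rewrite indicE.
- move=> B mB; rewrite integral_indic//; last exact: measurableC.
  have mBN : measurable (B `&` N) by exact: measurableI.
  have mBN' : measurable (~` N `&` B).
    by apply: measurableI => //; exact: measurableC.
  rewrite [RHS]PN// (measureDI mu_ac mB mN) setDE [B `&` ~` N]setIC.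
  have aBN : mu_ac (B `&` N) = 0%E.
    by apply/eqP; rewrite eq_le measure_ge0 andbT -aN le_measure// inE.
  by rewrite [X in (_ + X)%E]aBN adde0.
Qed.

End second_moment.

(** * The main theorem *)

Theorem theorem1p1 (R : realType) (d : measure_display)
    (Omega : measurableType d) (P : probability Omega R) (X : {RV P >-> R})
    (mu_ac mu_s : {measure set R -> \bar R}) :
  nondegenerate_RV X ->
  ('E_P[fun w => (X w ^+ 2)%R] < +oo)%E ->
  Lebesgue_decomposition (distribution P X) lebesgue_measure mu_ac mu_s ->
  [/\ (exists tau : R -> R, is_Stein_kernel X tau) <->
      (exists p : R -> R, is_density lebesgue_measure mu_ac p /\
         forall t, ess_interval X t -> 0 < p t),
      (exists nu : probability (measurableTypeR R) R,
         is_nonzero_biased X nu) /\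
      (forall nu : probability (measurableTypeR R) R,
         is_nonzero_biased X nu ->
         is_density lebesgue_measure nu (nzb_density X)),
      (forall p h : R -> R,
         is_density lebesgue_measure mu_ac p ->
         (forall t, ess_interval X t -> 0 < p t) ->
         is_density (distribution P X) mu_ac h ->
         (forall t, h t <= 1) ->
         is_Stein_kernel X (fun t =>
           if t \in ess_interval X then var X * (nzb_density X t / p t) * h t
           else 0))
    & forall tau : R -> R, is_Stein_kernel X tau ->
      [/\ forall tau' : R -> R, is_Stein_kernel X tau' ->
            {ae distribution P X, forall t, tau' t = tau t},
          {ae lebesgue_measure, forall t, closure (ess_interval X) t -> 0 < tau t},
          {ae mu_s, forall t, tau t = 0}
        & forall c, (0 < P [set w | X w = c])%E -> tau c = 0]].
Proof.
move=> ndX EX2 decomp; split.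
- split=> [[tau S]|[p [pE p0]]].
    exact: (positive_density_of_Stein_kernel EX2 decomp S).
  have [h hE] := exists_density_ac decomp.
  by eexists; exact: (Stein_kernel_of_density EX2 ndX pE p0 hE).
- split; first exact: exists_nonzero_biased.
  by move=> nu; exact: nonzero_biased_density.
- move=> p h pE p0 hE _; exact: (Stein_kernel_of_density EX2 ndX pE p0 hE).
- move=> tau S; split.
  + by move=> tau' S'; exact: (Stein_kernel_unique EX2 S S').
  + exact: Stein_kernel_gt0.
  + exact: (Stein_kernel_singular EX2 decomp S).
  + move=> c Pc; apply/eqP; apply: contraTT Pc => tauc.
    have mc : measurable [set c] by exact: measurable_set1.
    rewrite -leNgt -(Stein_kernel_null EX2 S mc (lebesgue_measure_set1 c)).
    rewrite (_ : [set c] `&` _ = [set c])//.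
    by apply/seteqP; split=> t /=; [case|move=> ->].
Qed.
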